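(* For every numerical semigroup $S\neq\mathbb{N}$, $$g(S)=\Lambda(S)-\Theta(S),$$ and consequently $$W(S)=\bigl(e(S)-t(S)-1\bigr)\,n(S)+\sigma(S)+\Theta(S).$$
   Context: $\mathbb{N}=\{0,1,2,\dots\}$. A numerical semigroup is a submonoid $S\subseteq\mathbb{N}$ (under addition) with finite complement $G(S)=\mathbb{N}\setminus S$, whose elements are the gaps. Let $S\ne\mathbb{N}$. $g(S)=|G(S)|$ is the genus, $F=\max G(S)$, $c(S)=F+1$, $n(S)=|S\cap[0,c(S))|$, and $e(S)$ is the cardinality of the unique minimal system of generators of $S$. An integer $f$ is a pseudo-Frobenius number if $f\notin S$ and $f+s\in S$ for all $s\in S\setminus\{0\}$; $\mathrm{PF}(S)$ is the set of these and $t(S)=|\mathrm{PF}(S)|$. The Wilf number is $W(S)=e(S)n(S)-c(S)$. For $y\in\mathbb{Z}$, $\lambda_S(y)=|S\cap[0,y]|$; for an integer $x\in[1,F]$, $\nu_S(x)=|\{f\in\mathrm{PF}(S): f-x\in S\}|$. Define $$\Lambda(S)=\sum_{f\in\mathrm{PF}(S)}\lambda_S(f),\qquad \sigma(S)=\sum_{f\in\mathrm{PF}(S)}|S\cap(f,F]|,\qquad \Theta(S)=\sum_{x\in G(S)}(\nu_S(x)-1).$$ *)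

(* Defs.v *)
From mathcomp Require Import all_boot all_order all_algebra finmap.
From mathcomp Require Import all_classical.

Set Implicit Arguments.
Unset Strict Implicit.
Unset Printing Implicit Defensive.

Import Order.TTheory GRing.Theory Num.Theory.
Local Open Scope classical_set_scope.
Local Open Scope ring_scope.

(* Cardinality of a finite set; [fset_set A] is empty when [A] is infinite,
   so this is meaningful only for finite [A]. *)
Definition card (T : choiceType) (A : set T) : nat := #|` fset_set A|.

Definition submonoid (S : set nat) : Prop :=
  S 0%N /\ forall x y, S x -> S y -> S (x + y)%N.

Definition gaps (S : set nat) : set nat := ~` S.

Definition numerical_semigroup (S : set nat) : Prop :=
  submonoid S /\ finite_set (gaps S).

(* [S] seen inside the integers, so that membership of [f + s] and [f - x]
   uses integer (not truncated) arithmetic. *)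
Definition toZ (S : set nat) : set int := Posz @` S.

Definition genus (S : set nat) : nat := card (gaps S).

(* The maximum of the gaps; it is 0 for the excluded case of no gaps. *)
Definition frobenius (S : set nat) : nat := \max_(x <- fset_set (gaps S)) x.

Definition conductor (S : set nat) : nat := (frobenius S).+1.

Definition nleft (S : set nat) : nat :=
  card (toZ S `&` `[0, (conductor S)%:Z[).

Definition generates (A S : set nat) : Prop := smallest submonoid A = S.

Definition minimal_generators (S A : set nat) : Prop :=
  generates A S /\ forall B, B `<` A -> ~ generates B S.

(* [xget] selects the minimal system of generators, which is unique (and
   finite) for a numerical semigroup. *)
Definition embdim (S : set nat) : nat :=
  card (xget set0 [set A | minimal_generators S A]).

Definition PF (S : set nat) : set int :=
  [set f | ~ toZ S f /\ forall s, S s -> s <> 0%N -> toZ S (f + s%:Z)].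

Definition sg_type (S : set nat) : nat := card (PF S).

Definition wilf (S : set nat) : int :=
  (embdim S)%:Z * (nleft S)%:Z - (conductor S)%:Z.

Definition lambda (S : set nat) (y : int) : nat := card (toZ S `&` `[0, y]).

Definition nu (S : set nat) (x : int) : nat :=
  card [set f | PF S f /\ toZ S (f - x)].

(* The sums over [i \in A] below are the finitely supported sums over a set. *)
Definition Lambda (S : set nat) : int :=
  \sum_(f \in PF S) (lambda S f)%:Z.

Definition sigma (S : set nat) : int :=
  \sum_(f \in PF S) (card (toZ S `&` `]f, (frobenius S)%:Z]))%:Z.

Definition Theta (S : set nat) : int :=
  \sum_(x \in gaps S) ((nu S x%:Z)%:Z - 1).

(* Main.v *)
(** Every pseudo-Frobenius number [f] is a gap, so [s |-> f - s] is a bijection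
    from [S] on [0, f] onto the gaps [x] with [f - x] in [S].  Counting the pairs
    [(f, x)] both ways gives [Lambda S] as the sum of [nu S x] over all gaps,
    which is [Theta S + genus S].  The formula for the Wilf number is then
    [Lambda S + sigma S = sg_type S * nleft S] and
    [conductor S = nleft S + genus S]. *)
Require Import Defs.
From mathcomp Require Import all_boot all_order all_algebra finmap.
From mathcomp Require Import all_classical.
From mathcomp Require Import zify ring.

Import Order.TTheory GRing.Theory Num.Theory.
Local Open Scope classical_set_scope.
Local Open Scope ring_scope.

(** Brings finitely supported sums to the form of a big operator over ['I_N], where exchanging,
    splitting and reindexing are available. It serves with [h := Posz] for sets of integers and
    [h := id] for the gaps. *)
Lemma fsbig_ord_image {T : choiceType} {h : nat -> T} {A : set T} {N : nat}
    (F : T -> int) :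
  injective h -> A `<=` h @` `I_N ->
  \sum_(x \in A) F x = \sum_(i < N | `[< A (h i) >]) F (h i).
Proof.
move=> h_inj sub_A.
have finA : finite_set A.
  by apply: sub_finite_set sub_A _; apply/finite_image/finite_II.
rewrite fsbig_finite //=.
rewrite -(big_mkord (fun i => `[< A (h i) >]) (F \o h)).
rewrite -[RHS]big_filter -[RHS](big_map h predT F).
apply/perm_big/uniq_perm; first exact: fset_uniq.
  by rewrite map_inj_uniq // filter_uniq // iota_uniq.
move=> x; rewrite in_fset_set //; apply/idP/mapP => [/set_mem Ax|[i + ->]].
  have [i /= iN hix] := sub_A _ Ax.
  by exists i => //; rewrite mem_filter mem_index_iota iN hix leq0n !andbT; apply/asboolP.
by rewrite mem_filter => /andP[/asboolP Ai _]; apply/mem_set.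
Qed.

Lemma card_ord_image {T : choiceType} {h : nat -> T} {A : set T} {N : nat} :
  injective h -> A `<=` h @` `I_N ->
  (Defs.card A)%:Z = \sum_(i < N | `[< A (h i) >]) 1.
Proof.
move=> h_inj sub_A.
have finA : finite_set A.
  by apply: sub_finite_set sub_A _; apply/finite_image/finite_II.
rewrite -(fsbig_ord_image (fun=> 1) h_inj sub_A) fsbig_finite //=.
by rewrite big_const_seq count_predT iter_addr_0 /Defs.card natz.
Qed.

Lemma toZ_posE (S : set nat) (n : nat) : toZ S n%:Z = S n.
Proof. by apply/propext; split=> [[m Sm [<-]]|Sn] //; exists n. Qed.

(** When [f < x], truncated subtraction gives 0, which lies in every submonoid; hence the separate
    bound [x <= f]. *)
Lemma toZ_subE (S : set nat) (f x : nat) :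
  toZ S (f%:Z - x%:Z) <-> (x <= f)%N /\ S (f - x)%N.
Proof.
split=> [[s Ss fxs]|[xf Sfx]].
  have -> : f = (s + x)%N by lia.
  by rewrite leq_addl addnK.
by exists (f - x)%N => //; lia.
Qed.

Lemma gaps_lt_conductor {S : set nat} {x : nat} :
  numerical_semigroup S -> ~ S x -> (x < conductor S)%N.
Proof.
move=> [_ finG] nSx; rewrite /conductor ltnS /frobenius.
have xG : x \in fset_set (gaps S) by rewrite in_fset_set //; apply/mem_set.
by rewrite (big_rem _ xG) /= leq_maxl.
Qed.

(** Negative values have to be excluded: for the full monoid of naturals, -1 is pseudo-Frobenius.
    The assumption [S <> [set: nat]] supplies a gap to start from. *)
Lemma PF_sub_gaps {S : set nat} {f : int} :
  numerical_semigroup S -> S <> [set: nat] -> PF S f ->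
  exists2 x : nat, ~ S x & f = x%:Z.
Proof.
move=> hS hSN [nSf PFf].
case: f nSf PFf => [x|k] nSf PFf; first by exists x => //; rewrite -toZ_posE.
exfalso; apply: hSN; apply/seteqP; split=> // x _; apply: contrapT => nSx.
(* Going up from a gap in steps of [k + 1] > 0 never enters S. *)
have nSm m : ~ S (x + m * k.+1)%N.
  elim: m => [|m IHm]; first by rewrite mul0n addn0.
  move=> Sm; apply: IHm; rewrite -toZ_posE.
  have -> : (x + m * k.+1)%N%:Z = Negz k + (x + m.+1 * k.+1)%N%:Z by lia.
  by apply: PFf => //; lia.
(* Each step is at least 1, so [conductor S] of them lead to a gap that is too large. *)
have := gaps_lt_conductor hS (nSm (conductor S)); nia.
Qed.

Theorem proposition3p2 (S : set nat)
  (hS : numerical_semigroup S) (hSN : S <> [set: nat]) :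
  (genus S)%:Z = Lambda S - Theta S /\
  wilf S = ((embdim S)%:Z - (sg_type S)%:Z - 1) * (nleft S)%:Z
           + sigma S + Theta S.
Proof.
set c := conductor S.
have Posz_inj : injective Posz by move=> x y [].
have subI (A : set int) : (forall x, A x -> exists2 n : nat, (n < c)%N & x = n%:Z) ->
    A `<=` Posz @` `I_c.
  by move=> hA x /hA[n nc ->]; exists n.
have subPF : PF S `<=` Posz @` `I_c.
  apply: subI => f /(PF_sub_gaps hS hSN)[x nSx ->].
  by exists x => //; exact: gaps_lt_conductor.
have subG : gaps S `<=` id @` `I_c.
  by move=> x nSx; exists x => //; exact: gaps_lt_conductor.
(* Members of [toZ S] are nonnegative, so an upper bound on [A] is enough. *)
have subS (f : int) (A : set int) : f < c%:Z -> A `<=` [set x | x <= f] ->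
    toZ S `&` A `<=` Posz @` `I_c.
  move=> fc Af; apply: subI => _ [[n Sn <-] /Af /= nf]; exists n => //; lia.
pose s i := `[< S i >]; pose p (i : nat) := `[< PF S i%:Z >].
have genusE : (genus S)%:Z = \sum_(x < c | ~~ s x) 1.
  rewrite /genus (card_ord_image (@inj_id nat) subG).
  by apply: eq_bigl => x; rewrite /s -asbool_neg.
have nleftE : (nleft S)%:Z = \sum_(x < c | s x) 1.
  rewrite /nleft (card_ord_image (h := Posz) (N := c)) //.
    apply: eq_bigl => x; apply: asbool_equiv_eq; rewrite /setI /= toZ_posE in_itv /=.
    by split=> [[]//|Sx]; split=> //; exact: ltn_ord.
  by apply: (subS (frobenius S)%:Z) => [|x /=]; rewrite ?in_itv /= /c /conductor; lia.
have lambdaE (f : 'I_c) : (lambda S f%:Z)%:Z = \sum_(x < c | s x && (x <= f)%N) 1.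
  rewrite /lambda (card_ord_image (h := Posz) (N := c)) //.
    apply: eq_bigl => x; rewrite /s -[(x <= f)%N]asboolb -asbool_and.
    by apply: asbool_equiv_eq; rewrite /setI /= toZ_posE in_itv /= lez_nat.
  by apply: (subS f%:Z) => [|x /=]; rewrite ?in_itv /= ?ltz_nat //; lia.
have nuE (x : 'I_c) : (nu S x%:Z)%:Z =
    \sum_(f < c | p f && ((x <= f)%N && s (f - x)%N)) 1.
  rewrite /nu (card_ord_image (h := Posz) (N := c)) //.
    apply: eq_bigl => f; rewrite /s /p -[(x <= f)%N]asboolb -!asbool_and.
    by apply: asbool_equiv_eq => /=; rewrite toZ_subE.
  by move=> f [/subPF].
have typeE : (sg_type S)%:Z = \sum_(f < c | p f) 1.
  exact: card_ord_image.
have LambdaE : Lambda S = \sum_(f < c | p f) \sum_(x < c | s x && (x <= f)%N) 1.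
  rewrite /Lambda (fsbig_ord_image _ Posz_inj subPF).
  by apply: eq_bigr => f _; exact: lambdaE.
have ThetaE : Theta S = \sum_(x < c | ~~ s x)
    (\sum_(f < c | p f && ((x <= f)%N && s (f - x)%N)) 1 - 1).
  rewrite /Theta (fsbig_ord_image _ (@inj_id nat) subG).
  by apply: eq_big => [x|x _]; [rewrite /s -asbool_neg|rewrite -nuE].
have sigmaE : sigma S = \sum_(f < c | p f) \sum_(x < c | s x && ~~ (x <= f)%N) 1.
  rewrite /sigma (fsbig_ord_image _ Posz_inj subPF).
  apply: eq_bigr => f _; rewrite (card_ord_image (h := Posz) (N := c)) //.
    apply: eq_bigl => x; rewrite /s -[~~ (x <= f)%N]asboolb -asbool_and.
    apply: asbool_equiv_eq; rewrite /setI /= toZ_posE in_itv /= ltz_nat lez_nat.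
    (* Since [c] is [(frobenius S).+1], the upper end of the interval holds for every index. *)
    have xF : (x <= frobenius S)%N by rewrite -ltnS; exact: ltn_ord.
    by rewrite -ltnNge xF andbT.
  by apply: (subS (frobenius S)%:Z) => [|x /=]; rewrite ?in_itv /= /c /conductor; lia.
have reflect_gaps (f : 'I_c) : p f ->
    \sum_(x < c | s x && (x <= f)%N) 1 =
    \sum_(x < c | ~~ s x && ((x <= f)%N && s (f - x)%N)) 1 :> int.
  move=> /asboolP[nSf _]; rewrite toZ_posE in nSf.
  transitivity (\sum_(x < f.+1 | s x) 1 : int).
    by rewrite (big_ord_widen_cond c s (fun=> 1)).
  (* On ['I_f.+1], [rev_ord] is the reflection [x |-> f - x]; this is why the range was first cut
     down from [c] to [f.+1]. *)
  rewrite (reindex_inj rev_ord_inj) /=.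
  rewrite (big_ord_widen_cond c (fun x => s (f.+1 - x.+1)%N) (fun=> 1)) //.
  apply: eq_bigl => x; rewrite subSS ltnS andbC.
  case: (boolP (x <= f)%N) => [xf|]; rewrite ?andbF //=.
  case: (boolP (s (f - x)%N)) => [/asboolP Sfx|]; rewrite ?andbF // andbT.
  (* The reflected [x] is a gap: otherwise [f = (f - x) + x] would lie in [S]. *)
  apply/esym/negP => /asboolP Sx; apply: nSf; rewrite -(subnK xf).
  by case: hS => -[_ addS] _; exact: addS.
have Lambda_gaps : Lambda S = Theta S + (genus S)%:Z.
  rewrite LambdaE ThetaE genusE -big_split /= (eq_bigr _ reflect_gaps).
  (* The genus adds 1 at each gap and cancels the -1 in [Theta], leaving the sum of [nu] over the
     gaps. *)
  under [RHS]eq_bigr do rewrite subrK.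
  rewrite (exchange_big_dep (fun x : 'I_c => ~~ s x)) => [|f x _ /andP[]] //=.
  by apply: eq_bigr => x nsx; apply: eq_bigl => f; rewrite nsx.
have Lambda_sigma : Lambda S + sigma S = (sg_type S)%:Z * (nleft S)%:Z.
  rewrite LambdaE sigmaE typeE nleftE -big_split /= mulr_suml.
  apply: eq_bigr => f _; rewrite mul1r.
  (* For each [f], the elements of [S] below [c] split into those up to [f] and those above it. *)
  by rewrite [RHS](bigID (fun x : 'I_c => (x <= f)%N)).
have conductorE : (conductor S)%:Z = (nleft S)%:Z + (genus S)%:Z.
  rewrite nleftE genusE -(bigID (fun x : 'I_c => s x) predT) /=.
  by rewrite sumr_const card_ord natz.
split; first by rewrite Lambda_gaps; ring.
have -> : sigma S = (sg_type S)%:Z * (nleft S)%:Z - Lambda S.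
  by rewrite -Lambda_sigma; ring.
by rewrite /wilf conductorE Lambda_gaps; ring.
Qed.
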